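(* Let $(A,[\cdot,\cdot]_1,\cdot_1)$ be an almost Poisson algebra and let $(A^*,[\cdot,\cdot]_2,\cdot_2)$ be an almost Poisson algebra structure on the dual space $A^*$. Then $(A\oplus A^*,A,A^* )$ is a standard Manin triple of almost Poisson algebras (with respect to the bilinear form $\omega_d(x+\xi,y+\eta)=\langle x,\eta\rangle+\langle \xi,y\rangle$ for $x,y\in A$, $\xi,\eta\in A^*$) if and only if $(A,A^*,\varrho_1,\mu_1,\varrho_2,\mu_2)$ is a matched pair of almost Poisson algebras, where $$\varrho_1=\mathrm{ad}_A^*,\quad \mu_1=-L^*,\quad \varrho_2=\mathrm{ad}_{A^*}^*,\quad \mu_2=-L_{A^*}^*.$$
   Context: All vector spaces are finite dimensional over a field $\mathbb{K}$ of characteristic zero; $\langle\cdot,\cdot\rangle$ is the canonical pairing between a space and its dual. An almost Poisson algebra $(A,[\cdot,\cdot],\cdot)$ is a vector space with a commutative associative bilinear product $\cdot$ and a skew-symmetric bilinear bracket $[\cdot,\cdot]$ satisfying $[x,y\cdot z]=[x,y]\cdot z+y\cdot[x,z]$ for all $x,y,z$ (no Jacobi identity is assumed). A representation of a commutative associative algebra $(A,\cdot)$ is a pair $(V,\mu)$, with $\mu:A\to\mathrm{End}(V)$ linear and $\mu(x\cdot y)=\mu(x)\mu(y)$. A representation of an almost Poisson algebra $(A,[\cdot,\cdot],\cdot)$ is a triple $(V,\varrho,\mu)$ with $\varrho,\mu:A\to\mathrm{End}(V)$ linear such that $(V,\mu)$ is a representation of $(A,\cdot)$ and, for all $x,y\in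 A$, $\varrho(x\cdot y)=\mu(y)\varrho(x)+\mu(x)\varrho(y)$ and $\mu([x,y])=\varrho(x)\mu(y)-\mu(y)\varrho(x)$. For a linear map $\theta:A\to \mathrm{End}(V)$, the dual map $\theta^*:A\to\mathrm{End}(V^* )$ is defined by $\langle\theta^*(x)\xi,v\rangle=-\langle\xi,\theta(x)v\rangle$. Here $\mathrm{ad}_A(x)y=[x,y]_1$ and $L(x)y=x\cdot_1y$ on $A$, and $\mathrm{ad}_{A^*}(\xi)\eta=[\xi,\eta]_2$, $L_{A^*}(\xi)\eta=\xi\cdot_2\eta$ on $A^*$. Thus $\mathrm{ad}_A^*,L^*:A\to\mathrm{End}(A^* )$ and $\mathrm{ad}_{A^*}^*,L_{A^*}^*:A^*\to\mathrm{End}(A)$ (identifying $A^{**}=A$). Matched pair of commutative associative algebras: $(A_1,A_2,\mu_1,\mu_2)$ where $(A_i,\cdot_i)$ are commutative associative algebras, $\mu_1:A_1\to\mathrm{End}(A_2)$ and $\mu_2:A_2\to\mathrm{End}(A_1)$ are representations of $A_1$ and $A_2$ respectively, and for all $x_1,y_1\in A_1$, $x_2,y_2\in A_2$: $$\mu_1(x_1)(x_2\cdot_2y_2)=(\mu_1(x_1)x_2)\cdot_2y_2+\mu_1(\mu_2(x_2)x_1)y_2,$$ $$\mu_2(x_2)(x_1\cdot_1y_1)=(\mu_2(x_2)x_1)\cdot_1y_1+\mu_2(\mu_1(x_1)x_2)y_1.$$ Matched pair of almost Poisson algebras: $(A_1,A_2,\varrho_1,\mu_1,\varrho_2,\mu_2)$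 where $(A_i,[\cdot,\cdot]_i,\cdot_i)$ are almost Poisson algebras, $\varrho_1,\mu_1:A_1\to\mathrm{End}(A_2)$ and $\varrho_2,\mu_2:A_2\to\mathrm{End}(A_1)$ are linear, $(A_1,A_2,\mu_1,\mu_2)$ is a matched pair of commutative associative algebras, $(A_2,\varrho_1,\mu_1)$ and $(A_1,\varrho_2,\mu_2)$ are representations of the almost Poisson algebras $A_1$ and $A_2$ respectively, and for all $x_1,y_1\in A_1$, $x_2,y_2\in A_2$: $$\varrho_2(x_2)(x_1\cdot_1y_1)=(\varrho_2(x_2)x_1)\cdot_1y_1+x_1\cdot_1(\varrho_2(x_2)y_1)-\mu_2(\varrho_1(x_1)x_2)y_1-\mu_2(\varrho_1(y_1)x_2)x_1,$$ $$\varrho_1(x_1)(x_2\cdot_2y_2)=(\varrho_1(x_1)x_2)\cdot_2y_2+x_2\cdot_2(\varrho_1(x_1)y_2)-\mu_1(\varrho_2(x_2)x_1)y_2-\mu_1(\varrho_2(y_2)x_1)x_2,$$ $$[x_1,\mu_2(x_2)y_1]_1-\varrho_2(\mu_1(y_1)x_2)x_1=\mu_2(\varrho_1(x_1)x_2)y_1-(\varrho_2(x_2)x_1)\cdot_1y_1+\mu_2(x_2)[x_1,y_1]_1,$$ $$[x_2,\mu_1(x_1)y_2]_2-\varrho_1(\mu_2(y_2)x_1)x_2=\mu_1(\varrho_2(x_2)x_1)y_2-(\varrho_1(x_1)x_2)\cdot_2y_2+\mu_1(x_1)[x_2,y_2]_2.$$ A Manin triple of almost Poisson algebras $(P,P^+,P^-)$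 consists of an almost Poisson algebra $(P,[\cdot,\cdot],\cdot)$ and almost Poisson algebras $P^+,P^-$ together with a nondegenerate symmetric bilinear form $\omega$ on $P$ that is invariant, i.e. $\omega(x\cdot y,z)=\omega(x,y\cdot z)$ and $\omega([x,y],z)=\omega(x,[y,z])$, such that $P^\pm$ are almost Poisson subalgebras of $P$, $P=P^+\oplus P^-$ as vector spaces, and $P^+,P^-$ are isotropic for $\omega$. The triple $(A\oplus A^*,A,A^* )$ is a standard Manin triple if there is an almost Poisson algebra structure on $A\oplus A^*$, having the given almost Poisson algebras $A$ and $A^*$ as subalgebras, such that $(A\oplus A^*,A,A^* )$ is a Manin triple with respect to $\omega_d$. *)

(* Defs.v *)
From HB Require Import structures.
From mathcomp Require Import all_boot all_order all_algebra.

Set Implicit Arguments.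
Unset Strict Implicit.
Unset Printing Implicit Defensive.

Import GRing.Theory.
Local Open Scope ring_scope.

(* Finite-dimensional spaces are vectTypes and the dual of V is 'Hom(V, K^o).
   A bilinear operation on V is stored as a linear map V -> 'End(V), so that
   the operation itself is its family of left multiplications.  The algebras
   are not assumed to have a unit. *)

Record comm_assoc_alg (K : fieldType) (V : vectType K) := CommAssocAlg {
  ca_mul : 'Hom(V, 'End(V));
  ca_mulC : forall x y, ca_mul x y = ca_mul y x;
  ca_mulA : forall x y z, ca_mul x (ca_mul y z) = ca_mul (ca_mul x y) z
}.

Record almost_poisson_alg (K : fieldType) (V : vectType K) := AlmostPoissonAlg {
  ap_alg :> comm_assoc_alg V;
  ap_br : 'Hom(V, 'End(V));
  ap_br_skew : forall x y, ap_br x y = - ap_br y x;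
  ap_leibniz : forall x y z,
    ap_br x (ca_mul ap_alg y z)
      = ca_mul ap_alg (ap_br x y) z + ca_mul ap_alg y (ap_br x z)
}.

Notation "x *[ P ] y" := (ca_mul P x y)
  (at level 40, P at level 200, left associativity, format "x  *[ P ]  y")
  : ring_scope.
Notation "\[ x , y \]_ P" := (ap_br P x y)
  (at level 0, x, y at level 200, P at level 2, format "\[ x ,  y  \]_ P")
  : ring_scope.

Definition ad (K : fieldType) (V : vectType K) (P : almost_poisson_alg V) :
  'Hom(V, 'End(V)) := ap_br P.
Definition lmult (K : fieldType) (V : vectType K) (P : comm_assoc_alg V) :
  'Hom(V, 'End(V)) := ca_mul P.

Definition ca_rep (K : fieldType) (A V : vectType K) (P : comm_assoc_alg A)
    (mu : 'Hom(A, 'End(V))) : Prop :=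
  forall x y, mu (x *[P] y) = (mu x \o mu y)%VF.

Definition ap_rep (K : fieldType) (A V : vectType K) (P : almost_poisson_alg A)
    (rho mu : 'Hom(A, 'End(V))) : Prop :=
  [/\ ca_rep P mu,
      forall x y,
        rho (x *[P] y) = (mu y \o rho x)%VF + (mu x \o rho y)%VF
    & forall x y,
        mu \[x, y \]_P = (rho x \o mu y)%VF - (mu y \o rho x)%VF].

Definition ca_matched_pair (K : fieldType) (A1 A2 : vectType K)
    (P1 : comm_assoc_alg A1) (P2 : comm_assoc_alg A2)
    (mu1 : 'Hom(A1, 'End(A2))) (mu2 : 'Hom(A2, 'End(A1))) : Prop :=
  [/\ ca_rep P1 mu1,
      ca_rep P2 mu2,
      forall (x1 : A1) (x2 y2 : A2),
        mu1 x1 (x2 *[P2] y2) = mu1 x1 x2 *[P2] y2 + mu1 (mu2 x2 x1) y2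
    & forall (x1 y1 : A1) (x2 : A2),
        mu2 x2 (x1 *[P1] y1) = mu2 x2 x1 *[P1] y1 + mu2 (mu1 x1 x2) y1].

Record ap_matched_pair (K : fieldType) (A1 A2 : vectType K)
    (P1 : almost_poisson_alg A1) (P2 : almost_poisson_alg A2)
    (rho1 mu1 : 'Hom(A1, 'End(A2))) (rho2 mu2 : 'Hom(A2, 'End(A1))) : Prop :=
  ApMatchedPair {
  amp_ca : ca_matched_pair P1 P2 mu1 mu2;
  amp_rep1 : ap_rep P1 rho1 mu1;
  amp_rep2 : ap_rep P2 rho2 mu2;
  amp_rho2M : forall (x1 y1 : A1) (x2 : A2),
    rho2 x2 (x1 *[P1] y1)
      = rho2 x2 x1 *[P1] y1 + x1 *[P1] rho2 x2 y1
        - mu2 (rho1 x1 x2) y1 - mu2 (rho1 y1 x2) x1;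
  amp_rho1M : forall (x1 : A1) (x2 y2 : A2),
    rho1 x1 (x2 *[P2] y2)
      = rho1 x1 x2 *[P2] y2 + x2 *[P2] rho1 x1 y2
        - mu1 (rho2 x2 x1) y2 - mu1 (rho2 y2 x1) x2;
  amp_br1 : forall (x1 y1 : A1) (x2 : A2),
    \[x1, mu2 x2 y1 \]_P1 - rho2 (mu1 y1 x2) x1
      = mu2 (rho1 x1 x2) y1 - rho2 x2 x1 *[P1] y1 + mu2 x2 \[x1, y1 \]_P1;
  amp_br2 : forall (x1 : A1) (x2 y2 : A2),
    \[x2, mu1 x1 y2 \]_P2 - rho1 (mu2 y2 x1) x2
      = mu1 (rho2 x2 x1) y2 - rho1 x1 x2 *[P2] y2 + mu1 x1 \[x2, y2 \]_P2
}.

Lemma linfun_linE (K : fieldType) (U V : vectType K) (f : U -> V) :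
  linear f -> linfun f =1 f.
Proof.
move=> flin; pose F := GRing.isLinear.Build _ _ _ _ _ flin.
pose L : {linear U -> V} := HB.pack f F.
exact: (lfunE L).
Qed.

(* linfun f agrees with f only when f is linear; the lemmas ending in E below
   give the values of the maps built with it. *)

Definition dual_rep (K : fieldType) (A V : vectType K)
    (theta : 'Hom(A, 'End(V))) : 'Hom(A, 'End('Hom(V, K^o))) :=
  linfun (fun x : A =>
    linfun (fun xi : 'Hom(V, K^o) => - (xi \o theta x)%VF)).

Lemma dual_repE (K : fieldType) (A V : vectType K) (theta : 'Hom(A, 'End(V)))
    (x : A) (xi : 'Hom(V, K^o)) (v : V) :
  dual_rep theta x xi v = - xi (theta x v).
Proof.
have E1 (y : A) zeta :
    linfun (fun zeta : 'Hom(V, K^o) => - (zeta \o theta y)%VF) zeta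
      = - (zeta \o theta y)%VF.
  apply: linfun_linE => a f g; apply/lfunP=> w.
  by rewrite !lfun_simp opprD scalerN.
rewrite /dual_rep linfun_linE ?E1 ?lfun_simp // => a y z.
apply/lfunP=> zeta; rewrite !lfun_simp !E1.
apply/lfunP=> w; rewrite !lfun_simp linearP !lfun_simp linearP.
by rewrite opprD scalerN.
Qed.

Definition ev_bidual (K : fieldType) (V : vectType K) :
    'Hom(V, 'Hom('Hom(V, K^o), K^o)) :=
  linfun (fun v : V => linfun (fun xi : 'Hom(V, K^o) => (xi v : K^o))).

Lemma ev_bidualE (K : fieldType) (V : vectType K) (v : V)
    (xi : 'Hom(V, K^o)) : ev_bidual V v xi = xi v.
Proof.
have E1 (w : V) zeta :
    linfun (fun zeta : 'Hom(V, K^o) => (zeta w : K^o)) zeta = zeta w.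
  by apply: linfun_linE => a f g; rewrite !lfun_simp.
rewrite /ev_bidual linfun_linE ?E1 // => a y z.
by apply/lfunP=> zeta; rewrite !lfun_simp !E1 linearP.
Qed.

Lemma ev_bidual_inj (K : fieldType) (V : vectType K) :
  lker (ev_bidual V) == 0%VS.
Proof.
apply/lker0P=> v w evw.
rewrite (coord_vbasis (memvf v)) (coord_vbasis (memvf w)).
apply: eq_bigr => i _; congr (_ *: _).
pose f (u : V) : K^o := coord (vbasis fullv) i u.
have flin : linear f by move=> a x y; rewrite /f linearP.
have := congr1 (fun g : 'Hom('Hom(V, K^o), K^o) => g (linfun f)) evw.
by rewrite !ev_bidualE !linfun_linE.
Qed.

Lemma ev_bidualVK (K : fieldType) (V : vectType K) :
  cancel (ev_bidual V)^-1%VF (ev_bidual V).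
Proof.
move=> phi; apply: limg_lfunVK.
suff -> : limg (ev_bidual V) = fullv by rewrite memvf.
apply/eqP; rewrite eqEdim subvf /=.
have -> : \dim (limg (ev_bidual V)) = \dim {:V}.
  by apply: limg_dim_eq; rewrite (eqP (ev_bidual_inj V)) capv0.
have dim_dual (U : vectType K) : \dim {: 'Hom(U, K^o)} = \dim {:U}.
  by rewrite !dimvf -[RHS]muln1.
by rewrite !dim_dual.
Qed.

(* The dual of theta : B -> End(V^* ) as a map B -> End(V), the bidual of V
   being identified with V along the evaluation map. *)
Definition predual_rep (K : fieldType) (B V : vectType K)
    (theta : 'Hom(B, 'End('Hom(V, K^o)))) : 'Hom(B, 'End(V)) :=
  linfun (fun b : B =>
    ((ev_bidual V)^-1 \o dual_rep theta b \o ev_bidual V)%VF).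

Lemma predual_repE (K : fieldType) (B V : vectType K)
    (theta : 'Hom(B, 'End('Hom(V, K^o)))) (b : B) (xi : 'Hom(V, K^o)) (v : V) :
  xi (predual_rep theta b v) = - theta b xi v.
Proof.
rewrite /predual_rep linfun_linE; last first.
  move=> a y z; apply/lfunP=> w; rewrite !lfun_simp /=.
  by rewrite !linearP !lfun_simp linearP.
rewrite !lfun_simp /= -[LHS]ev_bidualE ev_bidualVK dual_repE.
by rewrite ev_bidualE.
Qed.

Record ap_embedding (K : fieldType) (A P : vectType K)
    (SA : almost_poisson_alg A) (SP : almost_poisson_alg P)
    (i : 'Hom(A, P)) : Prop := ApEmbedding {
  ape_inj : injective i;
  ape_mul : forall x y, i (x *[SA] y) = i x *[SP] i y;
  ape_br : forall x y, i \[x, y \]_SA = \[i x, i y \]_SP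
}.

(* P+ and P- are algebras in their own right, embedded as subalgebras of P. *)
Record manin_triple (K : fieldType) (P Pp Pm : vectType K)
    (SP : almost_poisson_alg P)
    (Sp : almost_poisson_alg Pp) (Sm : almost_poisson_alg Pm)
    (ip : 'Hom(Pp, P)) (im : 'Hom(Pm, P)) (omega : P -> P -> K) : Prop :=
  ManinTriple {
  mt_bilin : bilinear_for *%R *%R omega;
  mt_sym : forall x y, omega x y = omega y x;
  mt_nondeg : forall x, (forall y, omega x y = 0) -> x = 0;
  mt_inv_mul : forall x y z, omega (x *[SP] y) z = omega x (y *[SP] z);
  mt_inv_br : forall x y z, omega \[x, y \]_SP z = omega x \[y, z \]_SP;
  mt_subp : ap_embedding Sp SP ip;
  mt_subm : ap_embedding Sm SP im;
  mt_sum : (limg ip + limg im = fullv)%VS;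
  mt_direct : directv (limg ip + limg im);
  mt_isop : forall x y, omega (ip x) (ip y) = 0;
  mt_isom : forall x y, omega (im x) (im y) = 0
}.

Section Double.
Variables (K : fieldType) (A : vectType K).
Local Notation dA := 'Hom(A, K^o).

Definition incl1 : 'Hom(A, (A * dA)%type) := linfun (fun x : A => (x, 0 : dA)).
Definition incl2 : 'Hom(dA, (A * dA)%type) := linfun (fun xi : dA => (0 : A, xi)).

Lemma incl1E x : incl1 x = (x, 0).
Proof.
apply: linfun_linE => a u v; congr pair.
by rewrite /= scaler0 addr0.
Qed.

Lemma incl2E xi : incl2 xi = (0, xi).
Proof.
apply: linfun_linE => a u v; congr pair.
by rewrite /= scaler0 addr0.
Qed.

Definition omega_d (u v : A * dA) : K := v.2 u.1 + u.2 v.1.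

Definition standard_manin_triple (SA : almost_poisson_alg A)
    (SD : almost_poisson_alg dA) : Prop :=
  exists S : almost_poisson_alg (A * dA)%type,
    manin_triple S SA SD incl1 incl2 omega_d.

End Double.

(* Main.v *)
Require Import Defs.
From mathcomp Require Import all_boot all_order all_algebra ssrAC.

(** Both conditions say that one explicit pair of operations on the double is
    an almost Poisson algebra.

    Let [A1] and [A2] act on each other.  The bicrossed operation of sign [s]
    extends the operations of [A1] and [A2] to [A1 * A2] by letting the
    products of mixed elements be given by the two actions, the second order
    of the factors being obtained from the first through the sign: [s = 1] for
    the product, [s = -1] for the bracket.

    - Associativity and the Leibniz rule for the bicrossed operations are
      equalities of trilinear maps, so they may be tested on triples of
      homogeneous elements.  A triple with two entries in [A1] and one in [A2]
      gives one equation in each summand, and these are a compatibility axiom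
      and a representation axiom of a matched pair ([assoc_112],
      [leibniz_211], [leibniz_112]); exchanging [A1] and [A2] gives the other
      axioms, and commutativity gives the other orders of the entries.  Hence
      a matched pair is the same thing as an almost Poisson structure whose
      operations are bicrossed ([bicross_structure_matched],
      [matched_bicross_structure]).

    - In a Manin triple the invariant form determines the mixed products: if
      [F] is the product or the bracket, then pairing [F x b] with [c] gives
      the pairing of [x] with [F b c], and pairing it with [y] gives, up to
      sign, the pairing of [b] with [F x y].  By nondegeneracy [F] is bicrossed
      through the dual actions ([invariant_bicross]).  Conversely, for the
      bicrossed operation through the dual actions, the trilinear form
      obtained by pairing [F u v] with [w] is cyclically invariant, which is
      the invariance of the form ([bicross_invariant]).

    A sign [s] with [s * s = 1] lets the second part treat the product and the
    bracket at once.  It is carried out for two spaces in perfect duality, of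
    which [A] and its dual are an instance: the two summands then play
    symmetric roles, and no bidual has to be identified with [A]. *)

Set Implicit Arguments.
Unset Strict Implicit.
Unset Printing Implicit Defensive.

Import GRing.Theory.
Local Open Scope ring_scope.

(** * Bicrossed operations *)

Definition bilin_hom (K : fieldType) (U V W : vectType K) (f : U -> V -> W) :
  'Hom(U, 'Hom(V, W)) := linfun (fun u => linfun (f u)).

Lemma bilin_homE (K : fieldType) (U V W : vectType K) (f : U -> V -> W) :
  (forall u, linear (f u)) -> (forall v, linear (f^~ v)) ->
  forall u v, bilin_hom f u v = f u v.
Proof.
move=> linr linl u v; rewrite /bilin_hom linfun_linE.
  by rewrite linfun_linE.
move=> a x y; apply/lfunP=> w.
by rewrite add_lfunE scale_lfunE !linfun_linE ?linl.
Qed.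

Section Bicross.
Variables (K : fieldType) (A1 A2 : vectType K) (s : K).
Variables (f1 : 'Hom(A1, 'End(A1))) (f2 : 'Hom(A2, 'End(A2))).
Variables (l1 : 'Hom(A1, 'End(A2))) (l2 : 'Hom(A2, 'End(A1))).

Definition bicross : 'Hom((A1 * A2)%type, 'End((A1 * A2)%type)) :=
  bilin_hom (fun u v : A1 * A2 =>
    (f1 u.1 v.1 + l2 u.2 v.1 + s *: l2 v.2 u.1,
     f2 u.2 v.2 + l1 u.1 v.2 + s *: l1 v.1 u.2)).

Lemma bicrossE u v : bicross u v =
  (f1 u.1 v.1 + l2 u.2 v.1 + s *: l2 v.2 u.1,
   f2 u.2 v.2 + l1 u.1 v.2 + s *: l1 v.1 u.2).
Proof.
rewrite /bicross bilin_homE // => w a [x b] [y c]; congr pair => /=;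
rewrite !(linearP, add_lfunE, scale_lfunE) /=;
by rewrite !scalerDr !scalerA ?[s * a]mulrC [RHS]addrACA;
  congr +%R; rewrite addrACA.
Qed.

Lemma bicross_sym : s * s = 1 ->
  (forall x y, f1 x y = s *: f1 y x) -> (forall a b, f2 a b = s *: f2 b a) ->
  forall u v, bicross u v = s *: bicross v u.
Proof.
move=> ss sym1 sym2 u v; rewrite !bicrossE; congr pair => /=.
  by rewrite !scalerDr scalerA ss scale1r -sym1 addrAC.
by rewrite !scalerDr scalerA ss scale1r -sym2 addrAC.
Qed.

End Bicross.

Definition swap (T1 T2 : Type) (u : T1 * T2) : T2 * T1 := (u.2, u.1).

(** The construction does not distinguish the two summands, so each
    computation on mixed triples is made once and serves twice. *)
Lemma bicross_swap (K : fieldType) (A1 A2 : vectType K) (s : K)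
    (f1 : 'Hom(A1, 'End(A1))) (f2 : 'Hom(A2, 'End(A2)))
    (l1 : 'Hom(A1, 'End(A2))) (l2 : 'Hom(A2, 'End(A1))) u v :
  bicross s f2 f1 l2 l1 (swap u) (swap v) = swap (bicross s f1 f2 l1 l2 u v).
Proof. by rewrite !bicrossE. Qed.

Lemma swap_inj (T1 T2 : Type) : injective (@swap T1 T2).
Proof. by move=> [x b] [y c] [-> ->]. Qed.

(** * Testing trilinear identities on homogeneous triples *)

Section Homogeneous.
Variables (K : fieldType) (A1 A2 : vectType K).

Lemma pair_split (w : A1 * A2) : w = (w.1, 0) + (0, w.2).
Proof. by case: w => x b; congr pair; rewrite /= ?addr0 ?add0r. Qed.

Definition triadditive (T : zmodType)
    (F : A1 * A2 -> A1 * A2 -> A1 * A2 -> T) :=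
  [/\ forall v w, {morph F^~ v ^~ w : u u' / u + u'},
      forall u w, {morph F u ^~ w : v v' / v + v'}
    & forall u v, {morph F u v : w w' / w + w'}].

Lemma triadditive_ext (T : zmodType)
    (F G : A1 * A2 -> A1 * A2 -> A1 * A2 -> T) :
  triadditive F -> triadditive G ->
  (forall x y z, F (x, 0) (y, 0) (z, 0) = G (x, 0) (y, 0) (z, 0)) ->
  (forall x y c, F (x, 0) (y, 0) (0, c) = G (x, 0) (y, 0) (0, c)) ->
  (forall x b z, F (x, 0) (0, b) (z, 0) = G (x, 0) (0, b) (z, 0)) ->
  (forall x b c, F (x, 0) (0, b) (0, c) = G (x, 0) (0, b) (0, c)) ->
  (forall a y z, F (0, a) (y, 0) (z, 0) = G (0, a) (y, 0) (z, 0)) ->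
  (forall a y c, F (0, a) (y, 0) (0, c) = G (0, a) (y, 0) (0, c)) ->
  (forall a b z, F (0, a) (0, b) (z, 0) = G (0, a) (0, b) (z, 0)) ->
  (forall a b c, F (0, a) (0, b) (0, c) = G (0, a) (0, b) (0, c)) ->
  forall u v w, F u v w = G u v w.
Proof.
move=> [Fl Fm Fr] [Gl Gm Gr] e111 e112 e121 e122 e211 e212 e221 e222 u v w.
rewrite (pair_split u) (pair_split v) (pair_split w) !Fl !Gl !Fm !Gm !Fr !Gr.
by rewrite e111 e112 e121 e122 e211 e212 e221 e222.
Qed.

Lemma triadditiveD (T : zmodType)
    (F G : A1 * A2 -> A1 * A2 -> A1 * A2 -> T) :
  triadditive F -> triadditive G ->
  triadditive (fun u v w => F u v w + G u v w).
Proof.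
move=> [Fl Fm Fr] [Gl Gm Gr].
by split=> p q r t /=; rewrite ?(Fl, Gl) ?(Fm, Gm) ?(Fr, Gr) addrACA.
Qed.

Implicit Types F G : 'Hom((A1 * A2)%type, 'End((A1 * A2)%type)).

Lemma triadditive_left F G : triadditive (fun u v w => F (G u v) w).
Proof.
by split=> p q r t; rewrite !(linearD, add_lfunE) ?linearD ?add_lfunE.
Qed.

Lemma triadditive_right F G : triadditive (fun u v w => F u (G v w)).
Proof.
by split=> p q r t; rewrite !(linearD, add_lfunE) ?linearD ?add_lfunE.
Qed.

Lemma triadditive_middle F G : triadditive (fun u v w => F v (G u w)).
Proof.
by split=> p q r t; rewrite !(linearD, add_lfunE) ?linearD ?add_lfunE.
Qed.

End Homogeneous.

(** * Associativity and Leibniz rule on mixed triples *)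

Section BicrossHomogeneous.
Variables (K : fieldType) (A1 A2 : vectType K).
Variables (f1 : 'Hom(A1, 'End(A1))) (f2 : 'Hom(A2, 'End(A2))).
Variables (l1 : 'Hom(A1, 'End(A2))) (l2 : 'Hom(A2, 'End(A1))).
Variables (g1 : 'Hom(A1, 'End(A1))) (g2 : 'Hom(A2, 'End(A2))).
Variables (r1 : 'Hom(A1, 'End(A2))) (r2 : 'Hom(A2, 'End(A1))).
Local Notation mul := (bicross 1 f1 f2 l1 l2).
Local Notation br := (bicross (-1) g1 g2 r1 r2).

(** The second component is the module law of [l1], the first one the
    compatibility of [l2] with the product of [A1]; commutativity of [f1]
    brings the latter to the order of factors used for matched pairs. *)
Lemma assoc_112 (f1C : forall x y, f1 x y = f1 y x) x y c :
  mul (y, 0) (mul (x, 0) (0, c)) = mul (mul (y, 0) (x, 0)) (0, c) <->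
  l1 (f1 y x) c = l1 y (l1 x c) /\
  l2 c (f1 x y) = f1 (l2 c x) y + l2 (l1 x c) y.
Proof.
rewrite !bicrossE /= !(linear0, zero_lfunE, scale1r, add0r, addr0).
rewrite [f1 y (l2 c x)]f1C [f1 x y]f1C.
by split=> [[-> ->]|[-> ->]].
Qed.

(** The first component is the compatibility of [r2] with the product of
    [A1], the second one the rule for the action [r1] of a product. *)
Lemma leibniz_211 a y z :
  br (0, a) (mul (y, 0) (z, 0)) =
    mul (br (0, a) (y, 0)) (z, 0) + mul (y, 0) (br (0, a) (z, 0)) <->
  r2 a (f1 y z) = f1 (r2 a y) z + f1 y (r2 a z)
                  - l2 (r1 y a) z - l2 (r1 z a) y /\
  r1 (f1 y z) a = l1 z (r1 y a) + l1 y (r1 z a).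
Proof.
rewrite !bicrossE /= !(linear0, zero_lfunE, scale1r, scaleN1r, add0r, addr0).
rewrite !linearN /= !opp_lfunE.
have -> : f1 (r2 a y) z + f1 y (r2 a z) - l2 (r1 y a) z - l2 (r1 z a) y =
          f1 (r2 a y) z - l2 (r1 y a) z + (f1 y (r2 a z) - l2 (r1 z a) y).
  by rewrite [RHS]addrACA addrA.
split=> [[-> /(congr1 -%R)]|[-> ->]]; first by rewrite opprD !opprK.
by rewrite opprD.
Qed.

(** The first component is the compatibility of the bracket of [A1] with
    [l2], the second one the rule for the action [l1] of a bracket. *)
Lemma leibniz_112 x y c :
  br (x, 0) (mul (y, 0) (0, c)) =
    mul (br (x, 0) (y, 0)) (0, c) + mul (y, 0) (br (x, 0) (0, c)) <->
  g1 x (l2 c y) - r2 (l1 y c) x =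
    l2 (r1 x c) y - f1 y (r2 c x) + l2 c (g1 x y) /\
  l1 (g1 x y) c = r1 x (l1 y c) - l1 y (r1 x c).
Proof.
rewrite !bicrossE /= !(linear0, zero_lfunE, scale1r, scaleN1r, add0r, addr0).
rewrite !linearN /= [l2 (r1 x c) y - _]addrC [_ + l2 c _]addrC.
split=> [[-> ->]|[-> ->]]; first by rewrite addrK.
by congr pair; rewrite /= subrK.
Qed.
End BicrossHomogeneous.

(** * Matched pairs as bicrossed structures *)

Definition bicross_structure (K : fieldType) (A1 A2 : vectType K)
    (P1 : almost_poisson_alg A1) (P2 : almost_poisson_alg A2)
    (rho1 mu1 : 'Hom(A1, 'End(A2))) (rho2 mu2 : 'Hom(A2, 'End(A1)))
    (S : almost_poisson_alg (A1 * A2)%type) : Prop :=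
  ca_mul S = bicross 1 (ca_mul P1) (ca_mul P2) mu1 mu2 /\
  ap_br S = bicross (-1) (ap_br P1) (ap_br P2) rho1 rho2.

Section MatchedPair.
Variables (K : fieldType) (A1 A2 : vectType K).
Variables (P1 : almost_poisson_alg A1) (P2 : almost_poisson_alg A2).
Variables (rho1 mu1 : 'Hom(A1, 'End(A2))) (rho2 mu2 : 'Hom(A2, 'End(A1))).
Local Notation mul := (bicross 1 (ca_mul P1) (ca_mul P2) mu1 mu2).
Local Notation mul' := (bicross 1 (ca_mul P2) (ca_mul P1) mu2 mu1).
Local Notation br := (bicross (-1) (ap_br P1) (ap_br P2) rho1 rho2).
Local Notation br' := (bicross (-1) (ap_br P2) (ap_br P1) rho2 rho1).

(** Each axiom of a matched pair is a component of associativity or of the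
    Leibniz rule on a mixed triple. *)
Lemma bicross_structure_matched (S : almost_poisson_alg (A1 * A2)%type) :
  bicross_structure P1 P2 rho1 mu1 rho2 mu2 S ->
  ap_matched_pair P1 P2 rho1 mu1 rho2 mu2.
Proof.
case=> mulE brE.
have mulA u v w : mul u (mul v w) = mul (mul u v) w.
  by rewrite -mulE ca_mulA.
have leib u v w : br u (mul v w) = mul (br u v) w + mul v (br u w).
  by rewrite -mulE -brE ap_leibniz.
have mulA' u v w : mul' u (mul' v w) = mul' (mul' u v) w.
  by apply: (@swap_inj A2 A1); rewrite -!bicross_swap.
have leib' u v w : br' u (mul' v w) = mul' (br' u v) w + mul' v (br' u w).
  apply: (@swap_inj A2 A1); rewrite -[RHS]/(swap _ + swap _).
  by rewrite -!bicross_swap.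
have A112 x y c := (assoc_112 _ _ _ (ca_mulC P1) x y c).1 (mulA _ _ _).
have A221 x y c := (assoc_112 _ _ _ (ca_mulC P2) x y c).1 (mulA' _ _ _).
have L211 a y z := (leibniz_211 _ _ _ _ _ _ _ _ a y z).1 (leib _ _ _).
have L122 a y z := (leibniz_211 _ _ _ _ _ _ _ _ a y z).1 (leib' _ _ _).
have L112 x y c := (leibniz_112 _ _ _ _ _ _ _ _ x y c).1 (leib _ _ _).
have L221 x y c := (leibniz_112 _ _ _ _ _ _ _ _ x y c).1 (leib' _ _ _).
have rep1 : ca_rep P1 mu1.
  by move=> x y; apply/lfunP=> c; rewrite comp_lfunE; case: (A112 y x c).
have rep2 : ca_rep P2 mu2.
  by move=> a b; apply/lfunP=> z; rewrite comp_lfunE; case: (A221 b a z).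
split.
- split=> // [x a b|x y a]; first by case: (A221 a b x).
  by case: (A112 x y a).
- split=> // x y; apply/lfunP=> c; rewrite add_lfunE ?opp_lfunE !comp_lfunE.
    by case: (L211 c x y).
  by case: (L112 x y c).
- split=> // x y; apply/lfunP=> c; rewrite add_lfunE ?opp_lfunE !comp_lfunE.
    by case: (L122 c x y).
  by case: (L221 x y c).
- by move=> x y a; case: (L211 a x y).
- by move=> x a b; case: (L122 x a b).
- by move=> x y c; case: (L112 x y c); rewrite [_ *[P1] _]ca_mulC.
- by move=> z x y; case: (L221 x y z); rewrite [_ *[P2] _]ca_mulC.
Qed.

(** Of the six kinds of mixed triples, commutativity reduces associativity
    to two and the Leibniz rule to four: those which express the axioms of a
    matched pair. *)
Lemma matched_bicross_structure :
  ap_matched_pair P1 P2 rho1 mu1 rho2 mu2 ->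
  exists S, bicross_structure P1 P2 rho1 mu1 rho2 mu2 S.
Proof.
case=> [[mu1M mu2M mu1_der mu2_der] [_ rho1_mul mu1_br] [_ rho2_mul mu2_br]].
move=> rho2M rho1M br1 br2.
have mulC u v : mul u v = mul v u.
  rewrite -[RHS]scale1r; apply: bicross_sym => *; rewrite ?mul1r // scale1r.
    exact: ca_mulC.
  exact: ca_mulC.
have brN u v : br u v = - br v u.
  rewrite -scaleN1r; apply: bicross_sym => *;
    rewrite ?mulrNN ?mul1r // scaleN1r.
    exact: ap_br_skew.
  exact: ap_br_skew.
have A112 x y c :
    mul (y, 0) (mul (x, 0) (0, c)) = mul (mul (y, 0) (x, 0)) (0, c).
  by apply/(assoc_112 _ _ _ (ca_mulC P1)); rewrite mu1M comp_lfunE mu2_der.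
have A221' x y c :
    mul' (y, 0) (mul' (x, 0) (0, c)) = mul' (mul' (y, 0) (x, 0)) (0, c).
  by apply/(assoc_112 _ _ _ (ca_mulC P2)); rewrite mu2M comp_lfunE mu1_der.
have A221 x y c :
    mul (0, y) (mul (0, x) (c, 0)) = mul (mul (0, y) (0, x)) (c, 0).
  by apply: (@swap_inj A1 A2); rewrite -!bicross_swap A221'.
have L211 a y z : br (0, a) (mul (y, 0) (z, 0)) =
    mul (br (0, a) (y, 0)) (z, 0) + mul (y, 0) (br (0, a) (z, 0)).
  apply/leibniz_211; rewrite rho2M rho1_mul.
  by rewrite add_lfunE !comp_lfunE.
have L112 x y c : br (x, 0) (mul (y, 0) (0, c)) =
    mul (br (x, 0) (y, 0)) (0, c) + mul (y, 0) (br (x, 0) (0, c)).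
  apply/leibniz_112; rewrite br1 mu1_br [y *[P1] _]ca_mulC.
  by rewrite add_lfunE opp_lfunE !comp_lfunE.
have L122 a y z : br (a, 0) (mul (0, y) (0, z)) =
    mul (br (a, 0) (0, y)) (0, z) + mul (0, y) (br (a, 0) (0, z)).
  apply: (@swap_inj A1 A2); rewrite -[RHS]/(swap _ + swap _).
  rewrite -!bicross_swap; apply/leibniz_211; rewrite rho1M rho2_mul.
  by rewrite add_lfunE !comp_lfunE.
have L221 x y c : br (0, x) (mul (0, y) (c, 0)) =
    mul (br (0, x) (0, y)) (c, 0) + mul (0, y) (br (0, x) (c, 0)).
  apply: (@swap_inj A1 A2); rewrite -[RHS]/(swap _ + swap _).
  rewrite -!bicross_swap; apply/leibniz_112.
  rewrite br2 mu2_br [y *[P2] _]ca_mulC.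
  by rewrite add_lfunE opp_lfunE !comp_lfunE.
have A121 x b z :
    mul (x, 0) (mul (0, b) (z, 0)) = mul (mul (x, 0) (0, b)) (z, 0).
  by rewrite [mul (0, b) _]mulC [RHS]mulC !A112 [mul (z, 0) _]mulC.
have A212 a y c :
    mul (0, a) (mul (y, 0) (0, c)) = mul (mul (0, a) (y, 0)) (0, c).
  by rewrite [mul (y, 0) _]mulC [RHS]mulC !A221 [mul (0, c) _]mulC.
have mulA u v w : mul u (mul v w) = mul (mul u v) w.
  apply: (@triadditive_ext _ _ _ _ (fun u v w => mul u (mul v w))
           (fun u v w => mul (mul u v) w));
    [exact: triadditive_right|exact: triadditive_left|..] => {u v w}.
  - move=> x y z;
    rewrite !bicrossE /= !(linear0, zero_lfunE, scale1r, add0r, addr0).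
    by rewrite ca_mulA.
  - by move=> x y c; apply: A112.
  - by move=> x b z; apply: A121.
  - move=> x b c.
    by rewrite mulC -A221 [mul _ (x, 0)]mulC A212 [mul _ (x, 0)]mulC.
  - move=> a y z.
    by rewrite mulC -A112 [mul _ (0, a)]mulC A121 [mul _ (0, a)]mulC.
  - by move=> a y c; apply: A212.
  - by move=> a b z; apply: A221.
  - move=> a b c;
    rewrite !bicrossE /= !(linear0, zero_lfunE, scale1r, add0r, addr0).
    by rewrite ca_mulA.
have leib u v w : br u (mul v w) = mul (br u v) w + mul v (br u w).
  apply: (@triadditive_ext _ _ _ _ (fun u v w => br u (mul v w))
           (fun u v w => mul (br u v) w + mul v (br u w)));
    [exact: triadditive_right
    |apply: triadditiveD; [exact: triadditive_left|exact: triadditive_middle]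
    |..] => {u v w}.
  - move=> x y z;
    rewrite !bicrossE /= !(linear0, zero_lfunE, scale1r, add0r, addr0).
    by rewrite ap_leibniz; congr pair; rewrite /= addr0.
  - by move=> x y c; apply: L112.
  - move=> x b z.
    by rewrite mulC L112 addrC [mul (z, 0) _]mulC [mul _ (0, b)]mulC.
  - by move=> x b c; apply: L122.
  - by move=> a y z; apply: L211.
  - move=> a y c.
    by rewrite mulC L221 addrC [mul (0, c) _]mulC [mul _ (y, 0)]mulC.
  - by move=> a b z; apply: L221.
  - move=> a b c;
    rewrite !bicrossE /= !(linear0, zero_lfunE, scale1r, add0r, addr0).
    by rewrite ap_leibniz; congr pair; rewrite /= addr0.
by exists (@AlmostPoissonAlg _ _ (CommAssocAlg mulC mulA) br brN leib).
Qed.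

End MatchedPair.

(** * Manin triples for spaces in perfect duality *)

Section PerfectPairing.
Variables (K : fieldType) (A1 A2 : vectType K) (pr : A2 -> A1 -> K).
Hypothesis pr_bilin : bilinear_for *%R *%R pr.
Hypothesis pr_nondegl : forall x, (forall b, pr b x = 0) -> x = 0.
Hypothesis pr_nondegr : forall b, (forall x, pr b x = 0) -> b = 0.
Local Notation P := (A1 * A2)%type.

Definition pairing_form (u v : P) : K := pr v.2 u.1 + pr u.2 v.1.

Let prDl b c x : pr (b + c) x = pr b x + pr c x.
Proof. by rewrite -{1}[b]scale1r pr_bilin /= mul1r. Qed.
Let prDr b x y : pr b (x + y) = pr b x + pr b y.
Proof. by rewrite -{1}[x]scale1r pr_bilin /= mul1r. Qed.
Let pr0l x : pr 0 x = 0.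
Proof. by apply: (addrI (pr 0 x)); rewrite -prDl !addr0. Qed.
Let pr0r b : pr b 0 = 0.
Proof. by apply: (addrI (pr b 0)); rewrite -prDr !addr0. Qed.
Let prZl a b x : pr (a *: b) x = a * pr b x.
Proof. by rewrite -[a *: b]addr0 pr_bilin pr0l addr0. Qed.
Let prZr a b x : pr b (a *: x) = a * pr b x.
Proof. by rewrite -[a *: x]addr0 pr_bilin pr0r addr0. Qed.

Lemma pairing_form_bilin : bilinear_for *%R *%R pairing_form.
Proof.
split=> w a [x b] [y c];
  by rewrite /pairing_form /= !(prDl, prDr, prZl, prZr) mulrDr addrACA.
Qed.

Lemma pairing_form_sym (u v : P) : pairing_form u v = pairing_form v u.
Proof. by rewrite /pairing_form addrC. Qed.

Lemma pairing_form_scalel a (u v : P) :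
  pairing_form (a *: u) v = a * pairing_form u v.
Proof. by rewrite /pairing_form /= prZr prZl mulrDr. Qed.

Lemma pairing_form_nondeg (u : P) : (forall v, pairing_form u v = 0) -> u = 0.
Proof.
case: u => x b u0; congr pair; [apply: pr_nondegl => c|apply: pr_nondegr => y].
  by have := u0 (0, c); rewrite /pairing_form /= pr0r addr0.
by have := u0 (y, 0); rewrite /pairing_form /= pr0l add0r.
Qed.

Lemma pairing_form_ext (u v : P) :
  (forall y, pairing_form u (y, 0) = pairing_form v (y, 0)) ->
  (forall b, pairing_form u (0, b) = pairing_form v (0, b)) -> u = v.
Proof.
case: u v => x a [y b] uv1 uv2.
congr pair; apply/eqP; rewrite -subr_eq0 -scaleN1r; apply/eqP.
  apply: pr_nondegl => c; rewrite prDr prZr mulN1r.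
  by have := uv2 c; rewrite /pairing_form /= !pr0r !addr0 => ->; rewrite subrr.
apply: pr_nondegr => z; rewrite prDl prZl mulN1r.
by have := uv1 z; rewrite /pairing_form /= !pr0l !add0r => ->; rewrite subrr.
Qed.

Section Invariance.
Variables (s : K) (ss : s * s = 1).
Variables (f1 : 'Hom(A1, 'End(A1))) (f2 : 'Hom(A2, 'End(A2))).
Variables (l1 : 'Hom(A1, 'End(A2))) (l2 : 'Hom(A2, 'End(A1))).
Hypothesis l1E : forall x b y, pr (l1 x b) y = s * pr b (f1 x y).
Hypothesis l2E : forall a x b, pr b (l2 a x) = s * pr (f2 a b) x.

(** Written in this form, the two groups of three terms are cyclic sums, up
    to the symmetry of [f1] and [f2] of sign [s]. *)
Lemma pairing_form_bicross u v w :
  pairing_form (bicross s f1 f2 l1 l2 u v) w =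
    (pr w.2 (f1 u.1 v.1) + pr v.2 (s *: f1 u.1 w.1) + pr u.2 (f1 v.1 w.1)) +
    (pr (f2 u.2 v.2) w.1 + pr (s *: f2 u.2 w.2) v.1 + pr (f2 v.2 w.2) u.1).
Proof.
rewrite bicrossE /pairing_form /= !prDr !prDl !prZr !prZl !l1E !l2E.
rewrite !mulrA !ss !mul1r.
by rewrite [RHS](AC (3*3) ((1*5*6)*(4*2*3))).
Qed.

(** The form being symmetric, invariance says that the trilinear form of
    [pairing_form_bicross] is unchanged by a cyclic permutation. *)
Lemma bicross_invariant :
  (forall x y, f1 x y = s *: f1 y x) -> (forall a b, f2 a b = s *: f2 b a) ->
  forall u v w, pairing_form (bicross s f1 f2 l1 l2 u v) w
              = pairing_form u (bicross s f1 f2 l1 l2 v w).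
Proof.
move=> sym1 sym2 u v w.
rewrite [RHS]pairing_form_sym !pairing_form_bicross -!sym1 -!sym2.
by congr (_ + _); rewrite [RHS](AC 3 (2*3*1)).
Qed.

(** Invariance moves the pairing of a mixed product with an element of a
    summand to a product inside that summand, so the mixed products have no
    freedom left. *)
Lemma invariant_bicross (F : 'Hom(P, 'End(P))) :
  (forall u v, F u v = s *: F v u) ->
  (forall u v w, pairing_form (F u v) w = pairing_form u (F v w)) ->
  (forall x y, F (x, 0) (y, 0) = (f1 x y, 0)) ->
  (forall a b, F (0, a) (0, b) = (0, f2 a b)) ->
  F = bicross s f1 f2 l1 l2.
Proof.
move=> Fsym Finv F1 F2.
have F12 x b : F (x, 0) (0, b) = (s *: l2 b x, l1 x b).
  apply: pairing_form_ext => [y|c].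
    rewrite Fsym pairing_form_scalel Finv F1 /pairing_form /=.
    by rewrite !pr0l !add0r l1E.
  by rewrite Finv F2 /pairing_form /= !pr0r !addr0 prZr l2E mulrA ss mul1r.
have F21 b x : F (0, b) (x, 0) = (l2 b x, s *: l1 x b).
  rewrite Fsym F12; congr pair => /=.
  by rewrite scalerA ss scale1r.
apply/lfunP=> u; apply/lfunP=> v.
rewrite {1}(pair_split u) {1}(pair_split v) (linearD F) add_lfunE !linearD /=.
rewrite F1 F2 F12 F21 bicrossE; congr pair => /=.
  by rewrite addr0 addrAC.
by rewrite add0r addrA addrC addrA.
Qed.

End Invariance.

Section Manin.
Variables (P1 : almost_poisson_alg A1) (P2 : almost_poisson_alg A2).
Variables (r1 m1 : 'Hom(A1, 'End(A2))) (r2 m2 : 'Hom(A2, 'End(A1))).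
Variables (i1 : 'Hom(A1, P)) (i2 : 'Hom(A2, P)).
Hypothesis m1E : forall x b y, pr (m1 x b) y = pr b (x *[P1] y).
Hypothesis m2E : forall a x b, pr b (m2 a x) = pr (a *[P2] b) x.
Hypothesis r1E : forall x b y, pr (r1 x b) y = - pr b \[x, y\]_P1.
Hypothesis r2E : forall a x b, pr b (r2 a x) = - pr \[a, b\]_P2 x.
Hypothesis i1E : forall x, i1 x = (x, 0).
Hypothesis i2E : forall b, i2 b = (0, b).

Lemma limg_inclusions :
  (limg i1 + limg i2 = fullv)%VS /\ directv (limg i1 + limg i2).
Proof.
split.
  apply/eqP; rewrite eqEsubv subvf; apply/subvP=> u _.
  by rewrite (pair_split u) -i1E -i2E memv_add ?memv_img ?memvf.
apply/directv_addP/eqP; rewrite -subv0; apply/subvP=> u.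
rewrite memv_cap => /andP[/memv_imgP[x _ ->] /memv_imgP[b _]].
by rewrite i1E i2E => -[-> _]; rewrite memv0.
Qed.

Let m1E1 x b y : pr (m1 x b) y = 1 * pr b (x *[P1] y).
Proof. by rewrite mul1r. Qed.
Let m2E1 a x b : pr b (m2 a x) = 1 * pr (a *[P2] b) x.
Proof. by rewrite mul1r. Qed.
Let r1EN1 x b y : pr (r1 x b) y = -1 * pr b \[x, y\]_P1.
Proof. by rewrite mulN1r. Qed.
Let r2EN1 a x b : pr b (r2 a x) = -1 * pr \[a, b\]_P2 x.
Proof. by rewrite mulN1r. Qed.
Let sq1 : 1 * 1 = 1 :> K. Proof. exact: mulr1. Qed.
Let sqN1 : -1 * -1 = 1 :> K. Proof. by rewrite mulrNN mulr1. Qed.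
Let mul_sym (V : vectType K) (S : comm_assoc_alg V) x y :
  x *[S] y = 1 *: (y *[S] x).
Proof. by rewrite scale1r ca_mulC. Qed.
Let br_sym (V : vectType K) (S : almost_poisson_alg V) x y :
  \[x, y\]_S = -1 *: \[y, x\]_S.
Proof. by rewrite scaleN1r ap_br_skew. Qed.

(** An almost Poisson structure on the sum makes a Manin triple exactly when
    its two operations are bicrossed through the dual actions. *)
Lemma manin_triple_bicross (S : almost_poisson_alg P) :
  manin_triple S P1 P2 i1 i2 pairing_form <->
  bicross_structure P1 P2 r1 m1 r2 m2 S.
Proof.
split.
  move=> [_ _ _ invM invB [_ mul1 br1] [_ mul2 br2] _ _ _ _]; split.
    apply: (invariant_bicross sq1 m1E1 m2E1 (mul_sym S) invM) => [x y|a b].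
      by rewrite -!i1E mul1.
    by rewrite -!i2E mul2.
  apply: (invariant_bicross sqN1 r1EN1 r2EN1 (br_sym S) invB) => [x y|a b].
    by rewrite -!i1E br1.
  by rewrite -!i2E br2.
move=> [mulE brE]; have [sum_incl dir_incl] := limg_inclusions.
split; [exact: pairing_form_bilin|exact: pairing_form_sym
       |exact: pairing_form_nondeg| | | | |exact: sum_incl|exact: dir_incl| | ].
- rewrite mulE.
  exact: (bicross_invariant sq1 m1E1 m2E1 (mul_sym P1) (mul_sym P2)).
- rewrite brE.
  exact: (bicross_invariant sqN1 r1EN1 r2EN1 (br_sym P1) (br_sym P2)).
- split=> [x y|x y|x y]; rewrite ?mulE ?brE !i1E; first by case.
    by rewrite bicrossE /= !(linear0, zero_lfunE, scaler0, addr0).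
  by rewrite bicrossE /= !(linear0, zero_lfunE, scaler0, addr0).
- split=> [x y|x y|x y]; rewrite ?mulE ?brE !i2E; first by case.
    by rewrite bicrossE /= !(linear0, zero_lfunE, scaler0, addr0).
  by rewrite bicrossE /= !(linear0, zero_lfunE, scaler0, addr0).
- by move=> x y; rewrite !i1E /pairing_form /= !pr0l addr0.
- by move=> a b; rewrite !i2E /pairing_form /= !pr0r addr0.
Qed.

Lemma manin_triple_matched_pair :
  (exists S, manin_triple S P1 P2 i1 i2 pairing_form) <->
  ap_matched_pair P1 P2 r1 m1 r2 m2.
Proof.
split=> [[S /manin_triple_bicross]|/matched_bicross_structure[S bicrossS]].
  exact: bicross_structure_matched.
by exists S; apply/manin_triple_bicross.
Qed.

End Manin.
End PerfectPairing.

(** * The evaluation pairing of a space with its dual *)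

Lemma opp_dual_repE (K : fieldType) (A V : vectType K)
    (theta : 'Hom(A, 'End(V))) x (b : 'Hom(V, K^o)) v :
  (- dual_rep theta) x b v = b (theta x v).
Proof. by rewrite !opp_lfunE dual_repE opprK. Qed.

Lemma opp_predual_repE (K : fieldType) (B V : vectType K)
    (theta : 'Hom(B, 'End('Hom(V, K^o)))) a (b : 'Hom(V, K^o)) v :
  b ((- predual_rep theta) a v) = theta a b v.
Proof. by rewrite !opp_lfunE linearN /= predual_repE opprK. Qed.

Lemma evaluation_bilin (K : fieldType) (A : vectType K) :
  bilinear_for *%R *%R (fun (b : 'Hom(A, K^o)) (x : A) => b x : K).
Proof.
by split=> [x|b] a y z; rewrite ?linearP ?add_lfunE ?scale_lfunE.
Qed.

Lemma evaluation_nondegl (K : fieldType) (A : vectType K) (x : A) :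
  (forall b : 'Hom(A, K^o), b x = 0) -> x = 0.
Proof.
move=> bx0; apply/eqP.
rewrite -memv0 -(eqP (ev_bidual_inj A)) memv_ker; apply/eqP/lfunP=> b.
by rewrite ev_bidualE zero_lfunE.
Qed.

Lemma evaluation_nondegr (K : fieldType) (A : vectType K) (b : 'Hom(A, K^o)) :
  (forall x, b x = 0) -> b = 0.
Proof. by move=> bx0; apply/lfunP=> x; rewrite zero_lfunE. Qed.

Theorem theorem3p3 (K : fieldType) (charK0 : [pchar K] =i pred0)
    (A : vectType K)
    (PA : almost_poisson_alg A) (PD : almost_poisson_alg 'Hom(A, K^o)) :
  standard_manin_triple PA PD <->
  ap_matched_pair PA PD
    (dual_rep (ad PA)) (- dual_rep (lmult PA))
    (predual_rep (ad PD)) (- predual_rep (lmult PD)).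
Proof.

apply: (manin_triple_matched_pair (evaluation_bilin A)).
- exact: evaluation_nondegl.
- exact: evaluation_nondegr.
- by move=> x b y; apply: opp_dual_repE.
- by move=> a x b; apply: opp_predual_repE.
- by move=> x b y; apply: dual_repE.
- by move=> a x b; apply: predual_repE.
- exact: incl1E.
- exact: incl2E.
Qed.
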